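(* Let $m \le 153$ be a positive integer and let $C$ be an extremal binary doubly even self-dual $[24m,12m,4m+4]$ code. Let $D$ be the support design of the minimum weight $4m+4$ of $C$. If $D$ is a $t$-design for some $t \geq 6$, then $D$ is a $7$-design and $$m \in \{15,52,55,57,59,60,63,90,93,104,105,107,118,125,127,135,143,151\};$$ moreover, $D$ is never an $8$-design.
   Context: A binary linear code $C \subseteq \mathbb{F}_2^{n}$ is self-dual if $C = C^{\perp}$ with respect to the standard inner product, and doubly even if every codeword has Hamming weight divisible by $4$. A binary doubly even self-dual $[24m,12m,4m+4]$ code has length $24m$, dimension $12m$ and minimum weight $4m+4$; it is called extremal. The support of a codeword $c=(c_1,\dots,c_n)$ is $\mathrm{supp}(c)=\{i : c_i \neq 0\}$. The support design of $C$ for weight $w$ has as points the $n$ coordinate indices and as blocks the supports of all codewords of weight $w$. A $t$-$(v,k,\lambda)$ design is a pair $(X,\mathcal{B})$ where $|X|=v$ and $\mathcal{B}$ is a collection of $k$-subsets of $X$ (blocks) such that every $t$-subset of $X$ is contained in exactly $\lambda$ blocks; a $t$-design means a $t$-$(v,k,\lambda)$ design for some $\lambda$. *)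

(* Defs.v *)
From HB Require Import structures.
From mathcomp Require Import all_boot all_order all_algebra.

Set Implicit Arguments.
Unset Strict Implicit.
Unset Printing Implicit Defensive.

Import GRing.Theory.
Local Open Scope ring_scope.

Section Codes.
Variable n : nat.
Implicit Types (x y c : 'rV['F_2]_n) (C : {vspace 'rV['F_2]_n}).

Definition dotp x y : 'F_2 := \sum_(i < n) x 0 i * y 0 i.

Definition supp c : {set 'I_n} := [set i | c 0 i != 0].

Definition wt c : nat := #|supp c|.

Definition dual_code C : {set 'rV['F_2]_n} :=
  [set x | [forall c in C, dotp x c == 0]].

Definition self_dual C : Prop := C =i dual_code C.

Definition doubly_even C : Prop := forall c, c \in C -> (4 %| wt c)%N.

Definition min_weight C (d : nat) : Prop :=
  (exists c, [/\ c \in C, c != 0 & wt c = d]) /\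
  (forall c, c \in C -> c != 0 -> (d <= wt c)%N).

(* C is an [n, k, d] code; the length n is carried by the type of C. *)
Definition has_params C (k d : nat) : Prop := \dim C = k /\ min_weight C d.

(* Blocks of the support design for weight w; the points are 'I_n. Over F_2 a
   codeword is determined by its support, so no block is repeated. *)
Definition support_design C (w : nat) : {set {set 'I_n}} :=
  [set supp c | c in C & wt c == w].

End Codes.

Definition extremal_de_sd_code (m : nat) (C : {vspace 'rV['F_2]_(24 * m)})
  : Prop :=
  [/\ self_dual C, doubly_even C & has_params C (12 * m)%N (4 * m + 4)%N].

(* The usual convention t <= k <= v is made explicit: for t > k the block
   condition would hold vacuously with lambda = 0. *)
Definition is_design (X : finType) (B : {set {set X}}) (t v k lambda : nat)
  : Prop :=
  [/\ (t <= k <= v)%N,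
      #|X| = v,
      forall b, b \in B -> #|b| = k &
      forall S : {set X}, #|S| = t -> #|[set b in B | S \subset b]| = lambda].

(* The block size k is determined by B whenever B is nonempty. *)
Definition is_t_design (X : finType) (B : {set {set X}}) (t : nat) : Prop :=
  exists v k lambda : nat, is_design B t v k lambda.

(* Main.v *)
Require Import Defs.
From mathcomp Require Import all_boot all_order all_algebra all_field.
From mathcomp Require Import ring lra zify.
From Stdlib Require BinNat Nnat.

(** Write [d = 4 m + 4]. For a set [T] of [t] coordinates, Poisson summation over
    the self-dual code gives
      [sum_(c in C, T <= c) (1 + X)^(wt c - t) (1 - X)^(24 m - wt c)
         = 2^(12 m - t) sum_(z in C) X^|z \ T|],
    and extremality makes the right-hand side
    [2^(12 m - t) (1 + lambda(T) X^(d - t) + ...)], where [lambda(T)] is the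
    number of blocks containing [T]. With [a = (1 + X)^4], [b = (1 - X)^4] and
    [a - b = 8 X (1 + X^2)], multiplying by suitable powers of [1 / (1 - X^2)] and
    [1 / (1 + X^2)] and extracting one coefficient evaluates, by Lagrange
    inversion, the binomial [8^k 'C(wt c / 4 - m - 2, k)] at each word [c]; for
    well-chosen [k] it vanishes on all the middle weights.
    For [t = 5], [k = 4 m - 2] this yields [lambda_5 = 'C(5 m - 2, m - 1)].
    For [t = 7], [k = 4 m - 3] only the weights [d], [24 m - d] and [24 m]
    survive. Complementation turns the words of weight [24 m - d] containing [T]
    into the blocks disjoint from [T], whose number is a constant minus
    [lambda(T)] in a 6-design; hence [lambda(T)] is constant.
    The restrictions on [m] come from the integrality of [lambda_6], [lambda_7],
    [lambda_8], and from the parity of block intersections: for a block [c] and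
    points [p] in [c], [q] outside, the sum of ['C(|b :&: c| / 2, j)] over the
    blocks [b] containing [p] and [q] is an integer determined by the [lambda_s].
    The case [j = 4] excludes the remaining [m] for 7-designs, and [j = 6]
    excludes the 8-design for [m = 63]. *)

Set Implicit Arguments.
Unset Strict Implicit.
Unset Printing Implicit Defensive.

Import Order.TTheory GRing.Theory Num.Theory.

(** * Truncated power series *)

Section Series.
Local Open Scope ring_scope.
Variable M : nat.
Implicit Types p q r : {poly int}.

(** Congruence modulo [X^M]: polynomials stand for power series truncated at order [M]. *)
Definition eqX p q := forall i, (i < M)%N -> p`_i = q`_i.

Lemma eq_coef p q i : p = q -> p`_i = q`_i. Proof. by move=> ->. Qed.

Lemma eqX_refl p : eqX p p. Proof. by []. Qed.

Lemma eqX_trans q p r : eqX p q -> eqX q r -> eqX p r.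
Proof. by move=> pq qr i iM; rewrite pq ?qr. Qed.

Lemma eqX_mul p p' q q' : eqX p p' -> eqX q q' -> eqX (p * q) (p' * q').
Proof.
move=> pp' qq' i iM; rewrite !coefM; apply: eq_bigr => j _.
by have := ltn_ord j => ji; rewrite pp' ?qq' //; lia.
Qed.

Lemma eqX_exp p q n : eqX p q -> eqX (p ^+ n) (q ^+ n).
Proof. by move=> pq; elim: n => // n IHn; rewrite !exprS; apply: eqX_mul. Qed.

Lemma eqX_mul1 p q : eqX q 1 -> eqX (p * q) p.
Proof. by move=> q1; rewrite -[X in eqX _ X]mulr1; apply: eqX_mul. Qed.

Lemma eqX_exp1 p n : eqX p 1 -> eqX (p ^+ n) 1.
Proof. by move=> p1; rewrite -[X in eqX _ X](expr1n _ n); apply: eqX_exp. Qed.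

Lemma eqX_inverse_exists p : exists q, eqX (q * (1 - 'X * p)) 1.
Proof.
exists (\sum_(i < M) ('X * p) ^+ i) => i iM.
have := subrX1 ('X * p) M; set s := \sum_(i0 < M) _ => es.
have -> : s * (1 - 'X * p) = 1 - 'X^M * p ^+ M.
  by rewrite -exprMn -[RHS]opprB es; ring.
by rewrite coefB coefXnM iM subr0.
Qed.

Let a : {poly int} := (1 + 'X) ^+ 4.
Let b : {poly int} := (1 - 'X) ^+ 4.
Variables Q R : {poly int}.
Hypothesis Q_inv : eqX (Q * (1 + 'X^2)) 1.
Hypothesis R_inv : eqX (R * (1 - 'X^2)) 1.

(* The coefficient of [X^k] in [X * H' - k * H] vanishes, for [H = (b * Q)^k]. *)
Lemma coef_residue0 k : (0 < k < M)%N ->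
  (b ^+ k.-1 * (1 - 'X^2) ^+ 3 * Q ^+ k.+1)`_k = 0.
Proof.
case: k => // k /= kM.
(* Differentiate [Q * (1 + X^2) = 1]. The factor [X] restores the order of precision lost in
   differentiating a congruence modulo [X^M]. *)
have dQ : eqX ('X * Q^`()) (- 2%:R * 'X^2 * Q ^+ 2).
  have h : eqX ('X * (Q * (1 + 'X^2))^`()) 0.
    move=> i iM; rewrite coefXM coef0; case: i iM => //= i iM.
    by rewrite coef_deriv Q_inv // coef1 mul0rn.
  have e : (Q * (1 + 'X^2))^`() = Q^`() * (1 + 'X^2) + 2%:R * 'X * Q.
    by rewrite derivM !derivE /=; ring.
  move=> i iM.
  have e1 : eqX ('X * Q^`()) ('X * Q^`() * (Q * (1 + 'X^2))).
    by move=> l lM; rewrite (eqX_mul1 _ Q_inv).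
  have -> : - 2%:R * 'X^2 * Q ^+ 2 =
    'X * Q^`() * (Q * (1 + 'X^2)) - Q * ('X * (Q * (1 + 'X^2))^`()).
    by rewrite e; ring.
  rewrite coefB -e1 //.
  by rewrite (eqX_mul (@eqX_refl Q) h) // mulr0 coef0 subr0.
pose F : {poly int} := b * Q.
(* The numerator of [X * F' - F] over [(1 + X^2)^2] collapses to [- (1 - X)^3 * (1 + X)^3]. *)
have dF : eqX ('X * F^`() - F) (- (1 - 'X^2) ^+ 3 * Q ^+ 2).
  have -> : 'X * F^`() - F = ('X * b^`() - b) * Q + b * ('X * Q^`()).
    by rewrite /F derivM; ring.
  have eQ : eqX (('X * b^`() - b) * Q)
                (('X * b^`() - b) * (Q ^+ 2 * (1 + 'X^2))).
    apply: eqX_mul => // i iM.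
    by rewrite -(eqX_mul1 Q Q_inv) // mulrA -expr2.
  move=> i iM; rewrite coefD eQ // (eqX_mul (@eqX_refl b) dQ) // -coefD.
  by apply: eq_coef; rewrite /b derivE !derivE; ring.
have hk : ('X * (F ^+ k.+1)^`() - (k.+1)%:R * F ^+ k.+1)`_k.+1 = 0.
  by rewrite coefB coefXM /= coef_deriv mulr_natl coefMn subrr.
have e : 'X * (F ^+ k.+1)^`() - (k.+1)%:R * F ^+ k.+1 =
    (k.+1)%:R * (F ^+ k * ('X * F^`() - F)).
  rewrite deriv_exp /= -[X in 'X * X]mulr_natl exprS.
  by move: F^`() => F'; ring.
move: hk; rewrite {}e mulr_natl coefMn => /eqP.
rewrite mulrn_eq0 /= (eqX_mul (@eqX_refl (F ^+ k)) dF) // => /eqP h.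
rewrite -[LHS]opprK -coefN -[RHS]oppr0; congr (- _); rewrite -[RHS]h.
apply: eq_coef; rewrite /F; clearbody b; rewrite exprMn !exprS; ring.
Qed.

Lemma abE : a = b + 8%:R * 'X * (1 + 'X^2).
Proof. by rewrite /a /b; ring. Qed.

Lemma abR s : eqX ((a * b) ^+ s * R ^+ (4 * s)) 1.
Proof.
have -> : (a * b) ^+ s * R ^+ (4 * s) = (R * (1 - 'X^2)) ^+ (4 * s).
  rewrite [R ^+ _]exprM -exprMn [RHS]exprM; congr (_ ^+ s); rewrite /a /b; ring.
exact: eqX_exp1.
Qed.

(** Since [a * b = (1 - X^2)^4] and [R] cancels one factor [1 - X^2], the case [k > 0] is the
    vanishing residue. This orthogonality is the core of the Lagrange inversion. *)
Lemma coef_abRQ k : (k < M)%N -> (a * b ^+ k * R * Q ^+ k.+1)`_k = (k == 0)%:R.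
Proof.
case: k => [|k] kM.
  have /(_ 0%N kM) := eqX_mul (eqX_mul (@eqX_refl a) R_inv) Q_inv.
  rewrite !(coef0M, coef0_prod, mulr1) /a.
  rewrite -![_`_0]horner_coef0 !hornerE /=.
  by rewrite !mulr1 !mul1r => ->.
rewrite -[RHS](@coef_residue0 k.+1 kM) /=.
have e : a * b ^+ k.+1 * R * Q ^+ k.+2 =
   b ^+ k * (1 - 'X^2) ^+ 3 * Q ^+ k.+2 * (R * (1 - 'X^2)).
  by rewrite exprS /a /b; ring.
by rewrite e (eqX_mul1 _ R_inv).
Qed.

(** Substituting [a = b + 8 X (1 + X^2)] in [coef_abRQ] at [k + 1] makes the coefficient at [k + 1]
    equal to [-8] times the one at [k]. *)
Lemma coef_bRQ k : (k < M)%N -> (b ^+ k.+1 * R * Q ^+ k.+1)`_k = (-8) ^+ k.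
Proof.
elim: k => [|k IHk] kM.
  have /(_ 0%N kM) := eqX_mul (eqX_mul (@eqX_refl b) R_inv) Q_inv.
  rewrite /b -!horner_coef0 !hornerE /=.
  by rewrite !mulr1 expr1n => ->.
have h := coef_abRQ kM; rewrite /= abE in h.
have kM' : (k < M)%N by lia.
have h2 : (('X * (8%:R * (b ^+ k.+1 * R * Q ^+ k.+1)))
   * (Q * (1 + 'X^2)))`_k.+1 = 8 * (-8) ^+ k.
  by rewrite (eqX_mul1 _ Q_inv) // coefXM /= mulr_natl coefMn IHk // mulr_natl.
rewrite [RHS]exprS mulNr -h2; apply/eqP; rewrite -addr_eq0 -coefD -[X in _ == X]h.
by apply/eqP; apply: eq_coef; rewrite !exprS; ring.
Qed.

Lemma coef_test_min k s : (k < M)%N ->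
  (a ^+ s * b ^+ (k.+1 + s) * R ^+ (4 * s).+1 * Q ^+ k.+1)`_k = (-8) ^+ k.
Proof.
move=> kM; rewrite -coef_bRQ // -[RHS](eqX_mul1 _ (abR s)) //.
apply: eq_coef; clearbody a b; rewrite exprMn exprD !exprS; ring.
Qed.

(** Expand [a ^ e] by the binomial theorem in [b] and [8 X (1 + X^2)]. The term of index [j] is a
    multiple of [X^j], and [coef_abRQ] at [k - j] kills it unless [j = k]. *)
Lemma coef_test_bin k s e f : (k < M)%N -> (e + f = k + s)%N ->
  (a ^+ (e + s).+1 * b ^+ f * R ^+ (4 * s).+1 * Q ^+ k.+1)`_k =
  (8 ^ k * 'C(e, k))%N%:R.
Proof.
move=> kM efs.
have -> : a ^+ (e + s).+1 * b ^+ f * R ^+ (4 * s).+1 * Q ^+ k.+1 =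
  \sum_(j < e.+1) 'X^j * (8 ^ j * 'C(e, j))%N%:R *
    ((1 + 'X^2) ^+ j * b ^+ (e - j + f) * a ^+ s.+1 * R ^+ (4 * s).+1
      * Q ^+ k.+1).
  rewrite -addnS exprD {1}abE exprDn -!mulrA big_distrl /=.
  apply: eq_bigr => j _; rewrite -mulr_natl natrM natrX !exprMn exprD.
  by rewrite [in LHS]mulrA; ring.
rewrite coef_sum.
have term (j : 'I_e.+1) : ('X^j * (8 ^ j * 'C(e, j))%N%:R *
    ((1 + 'X^2) ^+ j * b ^+ (e - j + f) * a ^+ s.+1 * R ^+ (4 * s).+1
      * Q ^+ k.+1))`_k = if j == k :> nat then (8 ^ k * 'C(e, k))%N%:R else 0.
  rewrite -mulrA coefXnM; case: ltnP => [kj|jk]; first by rewrite gtn_eqF.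
  have -> : (8 ^ j * 'C(e, j))%N%:R *
    ((1 + 'X^2) ^+ j * b ^+ (e - j + f) * a ^+ s.+1 * R ^+ (4 * s).+1
      * Q ^+ k.+1) = ((a * b ^+ (k - j) * R * Q ^+ (k - j).+1) *
       ((a * b) ^+ s * R ^+ (4 * s)) * (Q * (1 + 'X^2)) ^+ j)
       *+ (8 ^ j * 'C(e, j)).
    have -> : (e - j + f = k - j + s)%N by have := ltn_ord j; lia.
    have -> : (k.+1 = (k - j).+1 + j)%N by lia.
    clearbody a b; rewrite -[RHS]mulr_natl; congr (_ * _).
    move: (k - j)%N (4 * s)%N (1 + 'X^2) => d r S; rewrite !exprMn !exprD !exprS.
    ring.
  have kjM : (k - j < M)%N by lia.
  rewrite coefMn (eqX_mul1 _ (eqX_exp1 j Q_inv)) // (eqX_mul1 _ (abR s)) //.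
  rewrite coef_abRQ // subn_eq0.
  have [->|ne] := eqVneq (j : nat) k; first by rewrite leqnn.
  by rewrite leqNgt ltn_neqAle ne jk mul0rn.
rewrite (eq_bigr _ (fun j _ => term j)) -big_mkcond /=.
have [ek|ke] := ltnP e k.
  by rewrite bin_small // muln0 big1.
by rewrite (big_pred1 (Ordinal (ke : (k < e.+1)%N))).
Qed.

Lemma coef_geometric_exp N i : (i < M)%N ->
  ((\poly_(j < M) 1 : {poly int}) ^+ N.+1)`_i = 'C(N + i, i)%:R.
Proof.
elim: N i => [|N IHN] i iM; first by rewrite expr1 coef_poly iM add0n binn.
rewrite exprSr coefM.
have -> : \sum_(j < i.+1) ((\poly_(j < M) 1 : {poly int}) ^+ N.+1)`_j *
    (\poly_(j < M) 1 : {poly int})`_(i - j) = (\sum_(j < i.+1) 'C(N + j, j))%:R.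
  rewrite natr_sum; apply: eq_bigr => j _; have := ltn_ord j => ji.
  by rewrite IHN ?coef_poly ?ifT ?mulr1 //; lia.
congr _%:R; elim: i {iM} => [|i IHi]; first by rewrite big_ord1 !bin0.
by rewrite big_ord_recr /= IHi [in RHS]addSn binS addSnnS addnC.
Qed.

(** [R * Q] is the truncated inverse of [1 - X^4], hence a geometric series in [X^4]. *)
Lemma coef_RQ_exp N i : (i < M)%N ->
  ((R * Q) ^+ N.+1)`_i = if (4 %| i)%N then 'C(N + i %/ 4, i %/ 4)%:R else 0.
Proof.
move=> iM; pose G : {poly int} := \poly_(j < M) 1.
have RQ : eqX (R * Q * (1 - 'X^4)) 1.
  have -> : R * Q * (1 - 'X^4) = R * (1 - 'X^2) * (Q * (1 + 'X^2)) by ring.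
  by apply: eqX_trans Q_inv; rewrite mulrC; apply: eqX_mul1.
have G4 : eqX ((G \Po 'X^4) * (1 - 'X^4)) 1.
  have -> : (G \Po 'X^4) * (1 - 'X^4) = 1 - 'X^(4 * M).
    have <- : (G * (1 - 'X)) \Po 'X^4 = (G \Po 'X^4) * (1 - 'X^4).
      by rewrite comp_polyM comp_polyB comp_polyC comp_polyX.
    have -> : G * (1 - 'X) = 1 - 'X^M.
      rewrite -[RHS]opprB subrX1 /G poly_def mulrC -mulNr opprB; congr (_ * _).
      by apply: eq_bigr => j _; rewrite scale1r.
    by rewrite rmorphB rmorph1 rmorphXn /= comp_polyX exprM.
  by move=> j jM; rewrite coefB coefXn; case: eqP => [|_]; [lia | rewrite subr0].
have e : eqX (R * Q) (G \Po 'X^4).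
  apply: (@eqX_trans (R * Q * ((G \Po 'X^4) * (1 - 'X^4)))).
    by move=> j jM; rewrite (eqX_mul1 _ G4).
  rewrite mulrCA; exact: eqX_mul1.
rewrite (eqX_exp N.+1 e) // -rmorphXn /= coef_comp_poly_Xn //.
by case: ifP => // d4; rewrite coef_geometric_exp //; lia.
Qed.

(** This evaluates the contribution of the zero word for [t = 5], after a shift of [m]. Inserting
    [(Q * (1 + X^2))^2] equalizes the exponents of [R] and [Q]; of the terms of
    [(1 + X) * (1 + X^2)^2] only [2 X^2] has the right degree modulo 4. *)
Lemma coef_test_const m : (4 * m + 2 < M)%N ->
  ((1 + 'X) * R ^+ (4 * m + 5) * Q ^+ (4 * m + 3))`_(4 * m + 2) =
  (2 * 'C(5 * m + 4, m))%N%:R.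
Proof.
move=> mM; have Q2 : eqX ((Q * (1 + 'X^2)) ^+ 2) 1 by apply: eqX_exp1.
rewrite -(eqX_mul1 _ Q2) //.
have -> : (1 + 'X) * R ^+ (4 * m + 5) * Q ^+ (4 * m + 3) *
   (Q * (1 + 'X^2)) ^+ 2 = (R * Q) ^+ (4 * m + 4).+1 * (1 + 'X) *
     (1 + 2%:R * 'X^2 + 'X^4).
  move: (4 * m)%N => n; rewrite [(R * Q) ^+ _]exprMn -addnS !exprD.
  move: (R ^+ n) (Q ^+ n) => r q; ring.
set p := _ ^+ _.
have -> : p * (1 + 'X) * (1 + 2%:R * 'X^2 + 'X^4) =
   p + p * 'X + (p * 'X^2) *+ 2 + (p * 'X^3) *+ 2 + p * 'X^4 + p * 'X^5.
  ring.
rewrite !coefD !coefMXn coefMX !coef_RQ_exp; [|lia..].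
have z k (c : int) : (2 < k < 6)%N -> (if (4 * m + 2 < k)%N then 0
    else if (4 %| 4 * m + 2 - k)%N then c else 0) = 0 :> int.
  by move=> k36; case: ltnP => // km; rewrite ifF //; apply/negP; lia.
rewrite !(z 3) // (z 4) // (z 5) //.
have -> : (4 %| 4 * m + 2)%N = false by lia.
have -> : (4 %| (4 * m + 2).-1)%N = false by lia.
have -> : (4 * m + 2 == 0)%N = false by lia.
have -> : (4 * m + 2 < 2)%N = false by lia.
rewrite addnK mulKn // dvdn_mulr //.
have -> : (4 * m + 4 + m = 5 * m + 4)%N by lia.
by rewrite natrM; ring.
Qed.
End Series.

(** * Self-dual codes *)

Section Poisson.
Local Open Scope ring_scope.
Variable n : nat.
Implicit Types (x y c z : 'rV['F_2]_n) (C : {vspace 'rV['F_2]_n}).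

Lemma F2_eq01 (x : 'F_2) : x = (x != 0)%:R.
Proof. by case: x => [[|[|[]]]] //= i; apply/val_inj. Qed.

(** The nontrivial additive character of [F_2], valued in the ring where the generating functions
    live. *)
Definition sgn2 (x : 'F_2) : {poly int} := (-1) ^+ (x != 0).

Lemma sgn2D (x y : 'F_2) : sgn2 (x + y) = sgn2 x * sgn2 y.
Proof.
have F2_cases (u : 'F_2) : u = 0 \/ u = 1.
  by rewrite (F2_eq01 u); case: (u != 0); [right | left].
by case: (F2_cases x) (F2_cases y) => -> [] ->; rewrite /sgn2 ?addr0 ?add0r
  ?addrr_pchar2 ?pchar_Fp ?eqxx ?oner_eq0 /= ?expr0 ?expr1 ?mulrNN ?mulr1 ?mul1r.
Qed.

Lemma sgn2_sum (I : finType) (F : I -> 'F_2) :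
  sgn2 (\sum_i F i) = \prod_i sgn2 (F i).
Proof.
by apply: (big_morph sgn2 sgn2D); rewrite /sgn2 eqxx expr0.
Qed.

Lemma dotpDr x y z : dotp x (y + z) = dotp x y + dotp x z.
Proof.
by rewrite /dotp -big_split; apply: eq_bigr => i _; rewrite mxE mulrDr.
Qed.

(** Orthogonality of characters: a word outside [C], which is its own dual, pairs to 1 with some
    [z0] in [C], and translation by [z0] negates the sum. *)
Lemma sum_sgn2_dotp C x : self_dual C ->
  \sum_(z in C) sgn2 (dotp x z) = if x \in C then #|C|%:R else 0.
Proof.
move=> sdC; case: ifPn => [xC|].
  rewrite -sum1_card natr_sum; apply: eq_bigr => z zC.
  have := sdC x; rewrite xC inE => /esym/forall_inP/(_ z zC)/eqP ->.
  by rewrite /sgn2 eqxx expr0.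
rewrite sdC inE negb_forall => /existsP[z0]; rewrite negb_imply => /andP[z0C h].
set S := \sum_(z in C) _.
have : S = - S.
  rewrite {1}/S (reindex_inj (addrI z0)) /= -sumrN.
  apply: eq_big => [z|z _]; first by rewrite rpredDl.
  by rewrite dotpDr sgn2D {1}/sgn2 h expr1 mulN1r.
move=> SN; apply/polyP => i; rewrite coef0.
have : S`_i = - S`_i by rewrite -coefN -SN.
by move: S`_i => s; lia.
Qed.

Lemma sum_rV_prod (F : 'I_n -> 'F_2 -> {poly int}) :
  \sum_(x : 'rV['F_2]_n) \prod_i F i (x 0 i) = \prod_i (F i 0 + F i 1).
Proof.
transitivity (\prod_i \sum_(b : 'F_2) F i b); last first.
  apply: eq_bigr => i _; rewrite (bigD1 0) // (bigD1 1) //= big_pred0 ?addr0 //.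
  by move=> b; rewrite (F2_eq01 b); case: (b != 0).
rewrite bigA_distr_bigA /= (reindex (fun f : {ffun 'I_n -> 'F_2} => \row_i f i)).
  by apply: eq_bigr => f _; apply: eq_bigr => i _; rewrite mxE.
exists (fun x : 'rV['F_2]_n => [ffun i => x 0 i]) => f _.
  by apply/ffunP => i; rewrite ffunE mxE.
by apply/rowP => i; rewrite mxE ffunE.
Qed.

(** The character sum detects membership in [C]; exchanging the two sums leaves a sum over all words
    that factors coordinatewise. *)
Lemma poisson_self_dual C (F : 'I_n -> 'F_2 -> {poly int}) : self_dual C ->
  #|C|%:R * (\sum_(c in C) \prod_i F i (c 0 i)) =
  \sum_(z in C) \prod_i (F i 0 + sgn2 (z 0 i) * F i 1).
Proof.
move=> sdC.
transitivity (\sum_(x : 'rV['F_2]_n)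
    (\prod_i F i (x 0 i)) * \sum_(z in C) sgn2 (dotp x z)).
  rewrite big_distrr /= big_mkcond /=; apply: eq_bigr => x _.
  by rewrite sum_sgn2_dotp //; case: ifP; rewrite ?mulr0 // mulrC.
under eq_bigr do rewrite big_distrr /=.
rewrite exchange_big /=; apply: eq_bigr => z _.
pose Fz i b := sgn2 (b * z 0 i) * F i b.
have e i : F i 0 + sgn2 (z 0 i) * F i 1 = Fz i 0 + Fz i 1.
  by rewrite /Fz mul0r mul1r [sgn2 0]/sgn2 eqxx expr0 mul1r.
rewrite (eq_bigr _ (fun i _ => e i)) -(sum_rV_prod Fz); apply: eq_bigr => x _.
by rewrite /dotp sgn2_sum -big_split /=; apply: eq_bigr => i _; rewrite mulrC.
Qed.

Lemma prod_supp c (T : {set 'I_n}) (f0 f1 g0 g1 : {poly int}) :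
  \prod_i (if i \in T then if c 0 i == 0 then f0 else f1
           else if c 0 i == 0 then g0 else g1) =
  f0 ^+ #|T :\: supp c| * f1 ^+ #|T :&: supp c| *
  (g0 ^+ #|~: (T :|: supp c)| * g1 ^+ #|supp c :\: T|).
Proof.
rewrite (bigID (mem T)) /=; congr (_ * _).
- rewrite (eq_bigr (fun i => if c 0 i == 0 then f0 else f1)); last by move=> i ->.
  rewrite (bigID (fun i => c 0 i == 0)) /=; congr (_ * _).
    rewrite -prodr_const; apply: eq_big => [i|i /andP[_ ->] //].
    by rewrite !inE negbK andbC.
  rewrite -prodr_const; apply: eq_big => [i|i /andP[_ /negbTE ->] //].
  by rewrite !inE.
- rewrite (eq_bigr (fun i => if c 0 i == 0 then g0 else g1)); last first.
    by move=> i /negbTE ->.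
  rewrite (bigID (fun i => c 0 i == 0)) /=; congr (_ * _).
    rewrite -prodr_const; apply: eq_big => [i|i /andP[_ ->] //].
    by rewrite !inE negb_or negbK.
  rewrite -prodr_const; apply: eq_big => [i|i /andP[_ /negbTE ->] //].
  by rewrite !inE.
Qed.

(** Poisson summation with local factors that vanish where a coordinate of [T] lies off the support.
    The transformed factors are [1] or [-1] on [T], and [2] or [-2 X] elsewhere. *)
Lemma macwilliams C (T : {set 'I_n}) : self_dual C -> doubly_even C ->
  #|C|%:R * (\sum_(c in C | T \subset supp c)
    (1 + 'X) ^+ (wt c - #|T|) * (1 - 'X) ^+ (n - wt c) : {poly int}) =
  (2 ^ (n - #|T|))%N%:R * \sum_(z in C) 'X^(#|supp z :\: T|).
Proof.
move=> sdC deC.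
pose F (i : 'I_n) (b : 'F_2) : {poly int} :=
  if i \in T then if b == 0 then 0 else 1 else if b == 0 then 1 - 'X else 1 + 'X.
have := @poisson_self_dual C F sdC.
have -> : \sum_(c in C) \prod_i F i (c 0 i) = \sum_(c in C | T \subset supp c)
    (1 + 'X) ^+ (wt c - #|T|) * (1 - 'X) ^+ (n - wt c).
  rewrite [RHS]big_mkcondr /=; apply: eq_bigr => c _.
  rewrite prod_supp expr0n expr1n mulr1 cards_eq0 setD_eq0.
  case: ifP => TS; last by rewrite mul0r.
  rewrite mul1r mulrC; congr (_ ^+ _ * _ ^+ _).
    by rewrite cardsD (setIidPr TS).
  by rewrite (setUidPr TS) cardsCs setCK card_ord.
move=> ->; rewrite big_distrr /=; apply: eq_bigr => z zC.
pose g i : {poly int} := if i \in T then if z 0 i == 0 then 1 else -1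
  else if z 0 i == 0 then 2%:R else - 2%:R * 'X.
rewrite (eq_bigr g); last first.
  move=> i _; rewrite /F /g /sgn2 eqxx oner_eq0.
  by case: (i \in T); case: (z 0 i == 0); rewrite ?expr0 ?expr1 //=; ring.
rewrite prod_supp expr1n mul1r.
have cU : #|T :|: supp z| = (#|T| + #|supp z :\: T|)%N.
  by rewrite -(cardsID T (T :|: supp z)) setDUl setDv set0U setIC setUC setKU.
have cC := cardsC (T :|: supp z); rewrite card_ord in cC.
have cD : wt z = (#|T :&: supp z| + #|supp z :\: T|)%N.
  by rewrite /wt -(cardsID T (supp z)) setIC.
have -> : (n - #|T| = #|~: (T :|: supp z)| + #|supp z :\: T|)%N by lia.
(* The signs from inside and outside [T] multiply to [(-1) ^ wt z], which is 1 because weights are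
   even. *)
have sg : (-1) ^+ #|T :&: supp z| * (-1) ^+ #|supp z :\: T| = 1 :> {poly int}.
  rewrite -exprD -cD -signr_odd -[RHS](expr0 (-1)); congr (_ ^+ _).
  by have := dvdn_trans (isT : 2 %| 4)%N (deC z zC); rewrite dvdn2 => /negbTE ->.
have -> : - 2%:R * 'X = -1 * 2%:R * 'X :> {poly int} by ring.
rewrite natrX -[RHS]mul1r -[X in _ = X * _]sg.
move: #|~: _| #|_ :\: _| #|_ :&: _| => r s t.
rewrite exprD ![(_ * _) ^+ s]exprMn.
move: ((-1) ^+ t) ((-1) ^+ s) (2%:R ^+ r) (2%:R ^+ s) => u v w w'; ring.
Qed.
End Poisson.

(** * Supports, parity of intersections and word counts *)

Section Words.
Local Open Scope ring_scope.

Lemma supp_inj n : injective (@supp n).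
Proof.
move=> c c' e; apply/rowP => i; rewrite (F2_eq01 (c 0 i)) (F2_eq01 (c' 0 i)).
by have /setP/(_ i) := e; rewrite !inE => ->.
Qed.

Lemma coef_natM (c : nat) (p : {poly int}) k : (c%:R * p)`_k = c%:R * p`_k.
Proof. by rewrite mulr_natl coefMn mulr_natl. Qed.

Lemma supp0 n : supp (0 : 'rV['F_2]_n) = set0.
Proof. by apply/setP => j; rewrite !inE mxE eqxx. Qed.

Definition ones n : 'rV['F_2]_n := const_mx 1.

Lemma supp_ones n : supp (ones n) = setT.
Proof. by apply/setP => i; rewrite !inE mxE oner_eq0. Qed.

Lemma supp_add n (x y : 'rV['F_2]_n) :
  supp (x + y) = (supp x :\: supp y) :|: (supp y :\: supp x).
Proof.
apply/setP => i; rewrite !inE mxE (F2_eq01 (x 0 i)) (F2_eq01 (y 0 i)).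
by case: (x 0 i != 0); case: (y 0 i != 0).
Qed.

Lemma dotpE n (x y : 'rV['F_2]_n) : dotp x y = #|supp x :&: supp y|%:R.
Proof.
rewrite /dotp -sum1_card natr_sum [RHS]big_mkcond /=; apply: eq_bigr => i _.
rewrite {1}(F2_eq01 (x 0 i)) {1}(F2_eq01 (y 0 i)) !inE.
by case: (x 0 i != 0); case: (y 0 i != 0); rewrite ?(mulr0, mul0r, mulr1).
Qed.

Lemma natr_F2_eq0 (k : nat) : (k%:R == 0 :> 'F_2) = ~~ odd k.
Proof. by rewrite -dvdn2 (dvdn_pcharf (pchar_Fp (isT : prime 2))). Qed.

Lemma self_dual_inter_even n (C : {vspace 'rV['F_2]_n}) x y :
  self_dual C -> x \in C -> y \in C -> ~~ odd #|supp x :&: supp y|.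
Proof.
move=> sdC xC yC; rewrite -natr_F2_eq0 -dotpE.
by have := sdC x; rewrite xC inE => /esym/forall_inP/(_ y yC).
Qed.

Definition nwords n (C : {vspace 'rV['F_2]_n}) (T : {set 'I_n}) (w : nat) :=
  #|[set c in C | (wt c == w) && (T \subset supp c)]|.

Lemma sum_wt_eq n (C : {vspace 'rV['F_2]_n}) (T : {set 'I_n}) (w : nat) :
  \sum_(c in C | T \subset supp c) (wt c == w)%:R = (nwords C T w)%:R :> int.
Proof.
rewrite -natr_sum /nwords -sum1_card; congr _%:R.
rewrite [RHS](eq_bigl (fun c => (c \in C) && (T \subset supp c) && (wt c == w))).
  by rewrite [RHS]big_mkcondr /=; apply: eq_bigr => c _; case: (_ == w).
by move=> c; rewrite inE -andbA [X in _ && X]andbC.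
Qed.

Lemma nblocks_nwords n (C : {vspace 'rV['F_2]_n}) (T : {set 'I_n}) w :
  #|[set b in support_design C w | T \subset b]| = nwords C T w.
Proof.
rewrite /nwords -(card_imset _ (@supp_inj n)); apply: eq_card => b.
rewrite inE; apply/andP/imsetP => [[/imsetP[c]]|[c]].
  by rewrite !inE => /andP[cC cw] -> Tb; exists c; rewrite ?inE ?cC ?cw.
rewrite !inE => /and3P[cC cw Tc] ->; split => //.
by apply/imsetP; exists c; rewrite ?inE ?cC ?cw.
Qed.
End Words.

(** * Coefficient extraction in an extremal code *)

Section Extremal.
Local Open Scope ring_scope.
Variable m : nat.
Hypothesis m_gt0 : (0 < m)%N.
Variable C : {vspace 'rV['F_2]_(24 * m)}.
Hypothesis exC : extremal_de_sd_code C.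

Let sdC : self_dual C. Proof. by case: exC. Qed.
Let deC : doubly_even C. Proof. by case: exC. Qed.
Let minC : min_weight C (4 * m + 4). Proof. by case: exC => _ _ []. Qed.

Lemma card_code : #|C| = (2 ^ (12 * m))%N.
Proof.
have [_ _ [dC _]] := exC.
by have := card_vspace C; rewrite dC card_Fp.
Qed.

Lemma ones_code : ones _ \in C.
Proof.
rewrite sdC inE; apply/forall_inP => c cC.
rewrite dotpE supp_ones setTI natr_F2_eq0 -dvdn2.
exact: dvdn_trans (deC cC).
Qed.

Lemma wt_compl (c : 'rV['F_2]_(24 * m)) : wt (c + ones _) = (24 * m - wt c)%N.
Proof.
rewrite /wt supp_add supp_ones setDT set0U setTD.
by rewrite cardsCs setCK card_ord.
Qed.

Lemma wt_le (c : 'rV['F_2]_(24 * m)) : (wt c <= 24 * m)%N.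
Proof. by rewrite -[X in (_ <= X)%N]card_ord; apply: max_card. Qed.

(** The all-one word lies in [C], so the minimum weight bounds both a word and its complement. *)
Lemma weights c : c \in C ->
  exists2 i, wt c = (4 * i)%N & [\/ i = 0%N, i = (6 * m)%N | (m < i < 5 * m)%N].
Proof.
move=> cC; have /dvdnP[i ei] := deC cC; exists i; first by rewrite ei mulnC.
have [_ dmin] := minC.
have [c0|c0] := eqVneq c 0.
  by constructor 1; move: ei; rewrite c0 /wt supp0 cards0; lia.
have [c1|c1] := eqVneq (c + ones _) 0.
  have := wt_compl c; rewrite c1 {1}/wt supp0 cards0.
  by have := wt_le c; rewrite -/(wt c); constructor 2; lia.
constructor 3; have := dmin _ cC c0; have := wt_le c.
have := dmin _ (rpredD cC ones_code) c1; rewrite wt_compl; lia.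
Qed.

Lemma nwords_full T : nwords C T (24 * m) = 1%N.
Proof.
rewrite /nwords -[RHS](cards1 (ones (24 * m))); apply: eq_card => c; rewrite !inE.
apply/idP/eqP => [/and3P[_ /eqP cw _]|->]; last first.
  by rewrite ones_code supp_ones subsetT /wt supp_ones cardsT card_ord eqxx.
apply: supp_inj; rewrite supp_ones; apply/eqP.
by rewrite eqEcard subsetT cardsT card_ord /= -/(wt c) cw.
Qed.

(** A nonzero word has at least [4 m + 4 - #|T|] support points outside [T], with equality exactly
    for the words of minimum weight containing [T]. Up to that degree only these words and the zero
    word contribute. *)
Lemma coef_dual_sum (T : {set 'I_(24 * m)}) (G : {poly int}) k :
  (#|T| < 4 * m + 4)%N -> (k <= 4 * m + 4 - #|T|)%N -> G`_0 = 1 ->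
  ((\sum_(z in C) 'X^(#|supp z :\: T|)) * G)`_k =
  G`_k + (if k == (4 * m + 4 - #|T|)%N then nwords C T (4 * m + 4) else 0%N)%:R.
Proof.
move=> td kd G0; have [_ dmin] := minC.
rewrite (bigD1 0) ?mem0v //= supp0 set0D cards0 expr0 mulrDl mul1r coefD.
congr (_ + _); rewrite big_distrl coef_sum /= /nwords -sum1_card.
have -> : (if k == (4 * m + 4 - #|T|)%N then
   (\sum_(c in [set c in C | (wt c == 4 * m + 4) && (T \subset supp c)]) 1)%N
   else 0%N) = (\sum_(z in C | (z != 0)%R)
    ((k == 4 * m + 4 - #|T|) && ((wt z == 4 * m + 4) && (T \subset supp z))))%N.
  case: eqP => _ /=; last by rewrite big1.
  rewrite (eq_bigl (fun z => ((z \in C) && (z != 0)) &&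
    ((wt z == (4 * m + 4)%N) && (T \subset supp z)))).
    by rewrite [LHS]big_mkcondr /=; apply: eq_bigr => z _; case: (_ && _).
  move=> z; rewrite inE; have [->|_] := eqVneq z 0; last by rewrite andbT.
  by rewrite andbF /wt supp0 cards0 addn4 andbF.
rewrite natr_sum; apply: eq_bigr => z /andP[zC z0].
rewrite coefXnM.
have wz : (4 * m + 4 <= wt z)%N := dmin z zC z0.
have cD := cardsID T (supp z); rewrite -/(wt z) in cD.
have cI : (#|supp z :&: T| <= #|T|)%N by rewrite subset_leq_card ?subsetIr.
case: ltnP => h.
  case: eqP => //= ke; case: eqP => //= we; case TS: (T \subset _) => //.
  by move: h; rewrite ke -we -cD (setIidPr TS) addKn ltnn.
have [ke we ie xe] : [/\ k = (4 * m + 4 - #|T|)%N, wt z = (4 * m + 4)%N,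
    #|supp z :&: T| = #|T| & #|supp z :\: T| = k].
  move: td kd wz cD cI h {G0}; move: (wt z) #|T| #|_ :&: _| #|_ :\: _| => w t i x.
  by split; lia.
have TS : T \subset supp z.
  have /eqP <- : supp z :&: T == T by rewrite eqEcard subsetIr ie leqnn.
  exact: subsetIl.
by rewrite xe we -ke !eqxx TS subnn G0.
Qed.

Lemma code_coef (T : {set 'I_(24 * m)}) (G : {poly int}) k :
  (#|T| < 4 * m + 4)%N -> (k <= 4 * m + 4 - #|T|)%N -> G`_0 = 1 ->
  (2 ^ (12 * m))%:R * (\sum_(c in C | T \subset supp c)
    ((1 + 'X) ^+ (wt c - #|T|) * (1 - 'X) ^+ (24 * m - wt c) * G)`_k) =
  (2 ^ (24 * m - #|T|))%:R * (G`_k +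
   (if k == (4 * m + 4 - #|T|)%N then nwords C T (4 * m + 4) else 0%N)%:R).
Proof.
move=> td kd G0; rewrite -coef_dual_sum // -coef_natM mulrA -macwilliams //.
rewrite card_code -mulrA coef_natM; congr (_ * _).
by rewrite big_distrl coef_sum.
Qed.

Implicit Types T : {set 'I_(24 * m)}.

Lemma wt_ge_card T c : T \subset supp c -> (#|T| <= wt c)%N.
Proof. exact: subset_leq_card. Qed.

(** The exponent [z] pads the power of [1 + X] to a multiple of 4, so that only [a] and [b] remain.
    At [i = m + 1] the value is [8^k] times the generalized binomial of [-1] over [k], which
    truncated subtraction cannot express. *)
Lemma word_coef M (Q R : {poly int}) i t z s k :
  eqX M (Q * (1 + 'X^2)) 1 -> eqX M (R * (1 - 'X^2)) 1 -> (k < M)%N ->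
  (m < i <= 6 * m)%N -> (t <= 4 * i)%N -> (k + s = 5 * m - 2)%N ->
  (4 * i - t + z = 4 * (i - m.+1 + s))%N ->
  ((1 + 'X) ^+ (4 * i - t) * (1 - 'X) ^+ (24 * m - 4 * i) *
     ((1 + 'X) ^+ z * R ^+ (4 * s).+1 * Q ^+ k.+1))`_k =
  if i == m.+1 then (-8) ^+ k else (8 ^ k * 'C(i - m - 2, k))%N%:R.
Proof.
move=> hQ hR kM im ti ks e.
have -> : (1 + 'X) ^+ (4 * i - t) * (1 - 'X) ^+ (24 * m - 4 * i) *
     ((1 + 'X) ^+ z * R ^+ (4 * s).+1 * Q ^+ k.+1) =
   ((1 + 'X) ^+ 4) ^+ (i - m.+1 + s) * ((1 - 'X) ^+ 4) ^+ (6 * m - i) *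
    R ^+ (4 * s).+1 * Q ^+ k.+1.
  rewrite -!exprM -e (_ : 4 * (6 * m - i) = 24 * m - 4 * i)%N; last lia.
  rewrite [(1 + 'X) ^+ (_ + _)]exprD !mulrA; congr (_ * _ * _).
  by rewrite -!mulrA; congr (_ * _); rewrite mulrC.
case: eqP => ei.
  rewrite (_ : i - m.+1 + s = s)%N; last lia.
  rewrite (_ : 6 * m - i = k.+1 + s)%N; last lia.
  exact: (coef_test_min hQ hR).
rewrite (_ : i - m.+1 + s = (i - m - 2 + s).+1)%N; last lia.
by apply: (coef_test_bin hQ hR) => //; lia.
Qed.

Lemma inverse_series_exist M : exists Q R : {poly int},
  eqX M (Q * (1 + 'X^2)) 1 /\ eqX M (R * (1 - 'X^2)) 1.
Proof.
have [Q hQ] := eqX_inverse_exists M (- 'X).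
have [R hR] := eqX_inverse_exists M 'X.
exists Q, R; split.
  by rewrite (_ : 1 + 'X^2 = 1 - 'X * - 'X) //; ring.
by rewrite (_ : 1 - 'X^2 = 1 - 'X * 'X) //; ring.
Qed.

Lemma coef0_inverse M (Q p : {poly int}) :
  (0 < M)%N -> eqX M (Q * p) 1 -> p`_0 = 1 -> Q`_0 = 1.
Proof.
by move=> M0 /(_ 0%N M0); rewrite coef0M coef1 => + p0; rewrite p0 mulr1.
Qed.

Lemma coef0_test M (Q R : {poly int}) x y z :
  (0 < M)%N -> eqX M (Q * (1 + 'X^2)) 1 -> eqX M (R * (1 - 'X^2)) 1 ->
  ((1 + 'X) ^+ x * R ^+ y * Q ^+ z)`_0 = 1.
Proof.
move=> M0 hQ hR.
have Q0 : Q`_0 = 1.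
  by apply: (coef0_inverse M0 hQ); rewrite coefD coef1 coefXn addr0.
have R0 : R`_0 = 1.
  by apply: (coef0_inverse M0 hR); rewrite coefB coef1 coefXn subr0.
have e0 (p : {poly int}) e : p`_0 = 1 -> (p ^+ e)`_0 = 1.
  by rewrite -!horner_coef0 horner_exp => ->; rewrite expr1n.
by rewrite !coef0M !e0 // coefD coef1 coefX.
Qed.

(** The degree [k = 4 m - 2] is below [4 m + 4 - 5], so the dual side is a constant. Middle weights
    have [i - m - 2 <= 4 m - 3 < k], so their binomials vanish and only the weights [4 m + 4] and
    [24 m] remain. *)
Lemma lambda5 T : #|T| = 5 -> nwords C T (4 * m + 4) = 'C(5 * m - 2, m - 1).
Proof.
move=> T5; have [Q [R [hQ hR]]] := inverse_series_exist (4 * m).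
pose k := (4 * m - 2)%N.
have M0 : (0 < 4 * m)%N by lia.
pose G := (1 + 'X) ^+ 1 * R ^+ (4 * m).+1 * Q ^+ k.+1.
have G0 : G`_0 = 1 by apply: (coef0_test _ _ _ M0).
have Td : (#|T| < 4 * m + 4)%N by rewrite T5; lia.
have kd : (k <= 4 * m + 4 - #|T|)%N by rewrite T5 /k; lia.
have := code_coef Td kd G0.
rewrite ifF; last by rewrite T5; apply/negP; rewrite /k; lia.
have Gk : G`_k = (2 * 'C(5 * m - 1, m - 1))%N%:R.
  have := @coef_test_const (4 * m) Q R hQ hR (m - 1).
  rewrite /G /k expr1.
  have -> : (4 * (m - 1) + 5 = (4 * m).+1)%N by lia.
  have -> : (4 * (m - 1) + 3 = (4 * m - 2).+1)%N by lia.
  have -> : (4 * (m - 1) + 2 = 4 * m - 2)%N by lia.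
  have -> : (5 * (m - 1) + 4 = 5 * m - 1)%N by lia.
  by apply; lia.
rewrite Gk addr0 T5.
rewrite (eq_bigr (fun c => (8 ^ k)%:R * ((wt c == (4 * m + 4)%N)%:R +
   (wt c == (24 * m)%N)%:R * ('C(5 * m - 2, k))%:R))); last first.
  move=> c /andP[cC Tc]; have := wt_ge_card Tc; rewrite T5.
  have [i -> hi wi] := weights cC.
  have im : (m < i <= 6 * m)%N by case: hi; lia.
  rewrite (@word_coef (4 * m)) //; [|rewrite /k; lia..].
  have [ei|ei] := eqVneq i m.+1.
    have -> : (4 * i == 4 * m + 4)%N by lia.
    have -> : (4 * i == 24 * m)%N = false by lia.
    rewrite mul0r addr0 mulr1 exprNn natrX -signr_odd.
    by rewrite (_ : odd k = false) ?mul1r // /k; lia.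
  have -> : (4 * i == 4 * m + 4)%N = false by lia.
  have [e6|e6] := eqVneq i (6 * m)%N.
    have -> : (4 * i == 24 * m)%N by lia.
    by rewrite mul1r add0r -natrM e6; congr (_ * 'C(_, _))%N%:R; lia.
  have -> : (4 * i == 24 * m)%N = false by lia.
  by rewrite mul0r addr0 mulr0 bin_small ?muln0 //; rewrite /k; case: hi; lia.
rewrite -big_distrr big_split -big_distrl /= !sum_wt_eq nwords_full //.
move=> h; have {}h : ((2 ^ (12 * m) * (8 ^ k * (nwords C T (4 * m + 4) +
    'C(5 * m - 2, k)))) = 2 ^ (24 * m - 5) * (2 * 'C(5 * m - 1, m - 1)))%N.
  apply/eqP; rewrite -(eqr_nat int) [X in _ == X]natrM -h !natrM natrD mul1r.
  by apply/eqP; ring.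
have e8 : (2 ^ (24 * m - 5) * 2 = 2 ^ (12 * m) * (8 ^ k * 4))%N.
  rewrite (_ : 8 = 2 ^ 3)%N // (_ : 4 = 2 ^ 2)%N // -expnM -expnSr -!expnD.
  by congr (_ ^ _)%N; rewrite /k; lia.
move: h; rewrite [X in _ = X]mulnA e8 -!mulnA => /eqP.
rewrite !eqn_pmul2l ?expn_gt0 // => /eqP h.
(* What is left is [lambda + 'C(5 m - 2, m) = 4 * 'C(5 m - 1, m - 1)]. Absorption turns the right
   side into ['C(5 m - 1, m)], and Pascal's rule isolates [lambda]. *)
have hb : ('C(5 * m - 2, k) = 'C(5 * m - 2, m))%N.
  by rewrite -bin_sub /k; [congr 'C(_, _); lia | lia].
have hc : (4 * 'C(5 * m - 1, m - 1) = 'C(5 * m - 1, m))%N.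
  have := mul_bin_left (5 * m - 1) (m - 1).
  rewrite (_ : (m - 1).+1 = m); last lia.
  rewrite (_ : 5 * m - 1 - (m - 1) = m * 4)%N; last lia.
  by rewrite -mulnA => /eqP; rewrite eqn_pmul2l // => /eqP ->.
have hd : ('C(5 * m - 1, m) = 'C(5 * m - 2, m) + 'C(5 * m - 2, m - 1))%N.
  have := binS (5 * m - 2) (m - 1).
  rewrite (_ : (m - 1).+1 = m); last lia.
  by rewrite (_ : (5 * m - 2).+1 = 5 * m - 1)%N //; lia.
lia.
Qed.

(** Here [k = 4 m - 3] equals [4 m + 4 - 7], so the block count also enters on the dual side. As [k]
    is odd, the words of minimum weight count with sign [-1]; the middle weight [20 m - 4] has
    binomial ['C(k, k) = 1], and lower ones vanish. *)
Lemma lambda7_affine : exists c0 : int, forall T, #|T| = 7 ->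
  (2 ^ (12 * m - 7) + 8 ^ (4 * m - 3))%:R * (nwords C T (4 * m + 4))%:R =
  (8 ^ (4 * m - 3))%:R * (nwords C T (20 * m - 4))%:R + c0.
Proof.
have [Q [R [hQ hR]]] := inverse_series_exist (4 * m).
pose k := (4 * m - 3)%N.
have M0 : (0 < 4 * m)%N by lia.
pose G := (1 + 'X) ^+ 7 * R ^+ (4 * m.+1).+1 * Q ^+ k.+1.
have G0 : G`_0 = 1 by apply: (coef0_test _ _ _ M0).
(* The two terms of [c0] come from the all-one word and from the zero word of the dual side. *)
exists ((8 ^ k)%:R * ('C(5 * m - 2, k))%:R - (2 ^ (12 * m - 7))%:R * G`_k).
move=> T T7.
have Td : (#|T| < 4 * m + 4)%N by rewrite T7; lia.
have kd : (k <= 4 * m + 4 - #|T|)%N by rewrite T7 /k; lia.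
have := code_coef Td kd G0.
rewrite ifT; last by rewrite T7 /k; lia.
rewrite T7 (eq_bigr (fun c => (8 ^ k)%:R * (- (wt c == (4 * m + 4)%N)%:R +
   (wt c == (20 * m - 4)%N)%:R +
   (wt c == (24 * m)%N)%:R * ('C(5 * m - 2, k))%:R))); last first.
  move=> c /andP[cC Tc]; have := wt_ge_card Tc; rewrite T7.
  have [i -> hi wi] := weights cC.
  have im : (m < i <= 6 * m)%N by case: hi; lia.
  rewrite (@word_coef (4 * m)) //; [|rewrite /k; lia..].
  have [ei|ei] := eqVneq i m.+1.
    have -> : (4 * i == 4 * m + 4)%N by lia.
    have -> : (4 * i == 24 * m)%N = false by lia.
    rewrite mul0r addr0.
    have -> : (4 * i == 20 * m - 4)%N = false by lia.
    rewrite addr0 mulrN1 exprNn natrX -signr_odd (_ : odd k) ?mulN1r //.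
    by rewrite /k; lia.
  have -> : (4 * i == 4 * m + 4)%N = false by lia.
  have [e6|e6] := eqVneq i (6 * m)%N.
    have -> : (4 * i == 24 * m)%N by lia.
    have -> : (4 * i == 20 * m - 4)%N = false by lia.
    by rewrite mul1r oppr0 !add0r -natrM e6; congr (_ * 'C(_, _))%N%:R; lia.
  have -> : (4 * i == 24 * m)%N = false by lia.
  rewrite mul0r addr0 oppr0 add0r.
  have [e5|e5] := eqVneq i (5 * m - 1)%N.
    have -> : (4 * i == 20 * m - 4)%N by lia.
    rewrite mulr1 (_ : i - m - 2 = k)%N ?binn ?muln1 //; rewrite /k; lia.
  have -> : (4 * i == 20 * m - 4)%N = false by lia.
  by rewrite mulr0 bin_small ?muln0 //; rewrite /k; case: hi; lia.
rewrite -big_distrr big_split -big_distrl big_split sumrN /= !sum_wt_eq.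
rewrite nwords_full // => h.
have e2 : (2 ^ (24 * m - 7))%:R =
    (2 ^ (12 * m))%:R * (2 ^ (12 * m - 7))%:R :> int.
  by rewrite -natrM -expnD; congr (2 ^ _)%N%:R; lia.
have p2 : (2 ^ (12 * m))%:R != 0 :> int by rewrite pnatr_eq0 expn_eq0.
move: h; rewrite e2 -mulrA => /(mulfI p2) h.
by rewrite natrD -/k; lra.
Qed.
End Extremal.

(** * Designs *)

Section Designs.
Variables (X : finType) (B : {set {set X}}).
Implicit Types S T P A b : {set X}.

Definition deg S := #|[set b in B | S \subset b]|.

Lemma degE S : deg S = \sum_(b in B) (S \subset b).
Proof.
rewrite /deg -sum1_card [RHS](eq_bigr (fun b => if S \subset b then 1 else 0)).
  by rewrite -big_mkcondr /=; apply: eq_bigl => b; rewrite inE.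
by move=> b _; case: (S \subset b).
Qed.

Lemma exists_set_card t : t <= #|X| -> exists S, #|S| = t.
Proof.
move=> tX; exists [set x in take t (enum X)].
rewrite cardsE (card_uniqP _) ?take_uniq ?enum_uniq // size_takel //.
by rewrite -cardE.
Qed.

(** Double counting of the pairs of a point [x] outside [S] and a block containing [S] and [x]. *)
Lemma sum_deg_setU1 t v k l S : is_design B t.+1 v k l -> #|S| = t ->
  deg S * (k - t) = l * (v - t).
Proof.
case=> _ vX kB degS St.
transitivity (\sum_(x in ~: S) deg (x |: S)); last first.
  rewrite (eq_bigr (fun=> l)).
    by rewrite sum_nat_const cardsCs setCK vX St mulnC.
  by move=> x; rewrite inE => xS; apply: degS; rewrite cardsU1 xS St.
rewrite (eq_bigr _ (fun x _ => degE (x |: S))) exchange_big /= degE big_distrl.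
apply: eq_bigr => b bB /=; under eq_bigr do rewrite subUset sub1set.
case Sb: (S \subset b); last by rewrite big1 // => x _; rewrite andbF.
rewrite mul1n -(kB b bB) -St -{1}(setIidPr Sb) -cardsD -sum1_card.
rewrite [RHS](eq_bigr (fun x => if x \in b then 1 else 0)).
  by rewrite -big_mkcondr /=; apply: eq_bigl => x; rewrite !inE.
by move=> x _; rewrite andbT; case: (x \in b).
Qed.

Lemma design_lambdas t v k l : is_design B t v k l ->
  exists L : nat -> nat, [/\ L t = l, forall s, s <= t -> is_design B s v k (L s)
    & forall s, s < t -> L s * (k - s) = L s.+1 * (v - s)].
Proof.
elim: t l => [|t IHt] l dB.
  by exists (fun=> l); split=> // s; rewrite leqn0 => /eqP ->.
have [tkv vX kB degS] := dB.
have [S0 S0t] : exists S, #|S| = t by apply: exists_set_card; lia.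
have dB' : is_design B t v k (deg S0).
  split=> //; first lia.
  move=> S St; apply/eqP; rewrite -(@eqn_pmul2r (k - t)); last lia.
  by apply/eqP; rewrite (sum_deg_setU1 dB S0t) (sum_deg_setU1 dB St).
have [L [Lt LB LE]] := IHt _ dB'.
exists (fun s => if s == t.+1 then l else L s); split; first by rewrite eqxx.
  move=> s; rewrite leq_eqVlt => /predU1P[->|st]; first by rewrite eqxx.
  by rewrite ltn_eqF //; apply: LB.
move=> s; rewrite ltnS leq_eqVlt => /predU1P[->|st].
  by rewrite ltn_eqF // eqxx Lt (sum_deg_setU1 dB S0t).
by rewrite !ltn_eqF ?LE //; lia.
Qed.

Section Family.
Variables (t v k : nat) (L : nat -> nat).
Hypothesis dL : forall s, s <= t -> is_design B s v k (L s).

Lemma deg_family S : #|S| <= t -> deg S = L #|S|.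
Proof. by move=> /dL [_ _ _ h]; apply: h. Qed.

(** Double counting of the pairs of a block [b] containing [P] and a [j]-subset of [b :&: A]:
    disjointness makes [P :|: J] a set of [#|P| + j] points. *)
Lemma sum_bin_inter P A j : [disjoint P & A] -> #|P| + j <= t ->
  \sum_(b in B | P \subset b) 'C(#|b :&: A|, j) = 'C(#|A|, j) * L (#|P| + j).
Proof.
move=> PA Pj; rewrite big_mkcondr /=.
transitivity (\sum_(b in B) \sum_(J : {set X} | (J \subset A) && (#|J| == j))
    (P :|: J \subset b)).
  apply: eq_bigr => b _; rewrite -cards_draws -sum1_card.
  under [RHS]eq_bigr do rewrite subUset.
  case: (P \subset b) => /=; last by rewrite big1.
  rewrite [RHS](eq_bigr (fun J : {set X} => if J \subset b then 1 else 0)).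
    rewrite -big_mkcondr /=; apply: eq_bigl => J.
    by rewrite inE subsetI; case: (J \subset b); rewrite ?andbF ?andbT.
  by move=> J _; case: (J \subset b).
rewrite exchange_big /= -cards_draws -sum1_card big_distrl /=.
apply: eq_big => [J|J /andP[JA /eqP Jj]]; first by rewrite inE.
have PJ : #|P :|: J| = #|P| + j.
  rewrite cardsU Jj (_ : P :&: J = set0) ?cards0 ?subn0 //.
  by apply/eqP; rewrite setI_eq0 (disjointWr JA).
by rewrite -degE deg_family PJ // mul1n.
Qed.
End Family.

Local Open Scope ring_scope.

(** Inclusion-exclusion: the indicator of disjointness is a product over the points of [T] of [1 -
    [i \in b]], expanded over subsets. *)
Lemma card_disjoint_blocks T :
  (#|[set b in B | [disjoint T & b]]|)%:R =
  \sum_(J : {set X} | J \subset T) (-1) ^+ #|J| * (deg J)%:R :> int.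
Proof.
have e b : ([disjoint T & b] : nat)%:R =
    \sum_(J : {set X} | J \subset T) (-1) ^+ #|J| * (J \subset b)%:R :> int.
  transitivity (\prod_i ((if i \in T then - (i \in b)%:R else 0) + 1 : int)).
    case: (boolP [disjoint T & b]) => [/pred0P TD|/pred0Pn[i /andP[/= iT ib]]].
      rewrite big1 // => i _; have := TD i => /=.
      by case: (i \in T) => //= ->; rewrite oppr0 add0r.
    by rewrite (bigD1 i) //= iT ib addNr mul0r.
  rewrite bigA_distr /= [RHS]big_mkcond /=; apply: eq_bigr => J _.
  rewrite -big_mkcond /=; case: ifPn => [JT|/subsetPn[i iJ iT]]; last first.
    by rewrite (bigD1 i) //= (negbTE iT) mul0r.
  rewrite (eq_bigr (fun i => - (i \in b)%:R)); last first.
    by move=> i iJ; rewrite (subsetP JT).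
  case: (boolP (J \subset b)) => [Jb|/subsetPn[i iJ ib]]; last first.
    by rewrite (bigD1 i) //= (negbTE ib) oppr0 mul0r mulr0.
  rewrite mulr1 -prodr_const; apply: eq_bigr => i iJ.
  by rewrite (subsetP Jb).
rewrite -sum1_card natr_sum.
transitivity (\sum_(b in B) (([disjoint T & b] : nat)%:R : int)).
  rewrite [RHS](eq_bigr (fun b => if [disjoint T & b] then 1 else 0)).
    by rewrite -big_mkcondr /=; apply: eq_bigl => b; rewrite inE.
  by move=> b _; case: [disjoint T & b].
rewrite (eq_bigr _ (fun b _ => e b)) exchange_big /=; apply: eq_bigr => J _.
by rewrite -big_distrr /= degE natr_sum.
Qed.

Lemma sum_subsets_card (f : nat -> int) T :
  \sum_(J : {set X} | (J \subset T) && (J != T)) f #|J| =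
  \sum_(j < #|T|) f j *+ 'C(#|T|, j).
Proof.
transitivity (\sum_(J : {set X} | J \subset T)
    \sum_(j < #|T|) if #|J| == j then f j else 0).
  rewrite [LHS]big_mkcondr /=; apply: eq_bigr => J JT.
  have [->|JnT] := eqVneq J T.
    by rewrite big1 // => j _; rewrite gtn_eqF.
  have lt : (#|J| < #|T|)%N by rewrite proper_card // properEneq JnT.
  by rewrite -big_mkcond /= (big_pred1 (Ordinal lt)).
rewrite exchange_big /=; apply: eq_bigr => j _.
rewrite -big_mkcondr /= -cards_draws -sumr_const; apply: eq_bigl => J.
by rewrite inE.
Qed.

(** In the inclusion-exclusion for a set of [t + 1] points, every term but the one of the full set
    is fixed by the [t]-design parameters. *)
Lemma card_disjoint_blocks_const t T T' (L : nat -> nat) :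
  (forall S, (#|S| <= t)%N -> deg S = L #|S|) -> #|T| = t.+1 -> #|T'| = t.+1 ->
  (#|[set b in B | [disjoint T & b]]|)%:R - (-1) ^+ t.+1 * (deg T)%:R =
  (#|[set b in B | [disjoint T' & b]]|)%:R - (-1) ^+ t.+1 * (deg T')%:R :> int.
Proof.
move=> dL.
have e S : #|S| = t.+1 ->
    (#|[set b in B | [disjoint S & b]]|)%:R - (-1) ^+ t.+1 * (deg S)%:R =
    \sum_(j < t.+1) ((-1) ^+ j * (L j)%:R) *+ 'C(t.+1, j) :> int.
  move=> St; rewrite card_disjoint_blocks (bigD1 S) //= St addrAC subrr add0r.
  rewrite -St -(sum_subsets_card (fun j => (-1) ^+ j * (L j)%:R)).
  apply: eq_bigr => J /andP[JS JnS]; rewrite dL //.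
  by rewrite -ltnS -St proper_card // properEneq JnS.
by move=> Tt T't; rewrite !e.
Qed.

End Designs.

(** * Restrictions on [m] *)

Section HalfBinomials.
Local Open Scope ring_scope.

Lemma natr_ffact (n k : nat) :
  (n ^_ k)%:R = \prod_(i < k) (n%:R - i%:R) :> int.
Proof.
elim: k => [|k IHk]; first by rewrite big_ord0.
rewrite big_ord_recr /= -IHk ffactnSr natrM.
have [kn|nk] := leqP k n; first by rewrite natrB.
by rewrite ffact_small // !mul0r.
Qed.

Lemma natr_bin_fact (n k : nat) :
  (k`!)%:R * ('C(n, k))%:R = \prod_(i < k) (n%:R - i%:R) :> int.
Proof. by rewrite -natrM mulnC bin_ffact natr_ffact. Qed.

(* Newton expansion at [y = 2 * h - 1] of [2 ^ 7 * 'C(h, 4)]. *)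
Lemma half_bin4 (h y : nat) : h.*2 = y.+1 ->
  128 * ('C(h, 4))%:R = - 5 + 5 * ('C(y, 1))%:R - 2 * ('C(y, 2))%:R
    - 4 * ('C(y, 3))%:R + 8 * ('C(y, 4))%:R :> int.
Proof.
move=> hy; have := natr_bin_fact h 4; have := natr_bin_fact y 1.
have := natr_bin_fact y 2; have := natr_bin_fact y 3; have := natr_bin_fact y 4.
have -> : y%:R = 2 * h%:R - 1 :> int by lia.
rewrite !big_ord_recr !big_ord0 /= !factS fact0.
move: h%:R ('C(y, 4))%:R ('C(y, 3))%:R ('C(y, 2))%:R ('C(y, 1))%:R ('C(h, 4))%:R.
move=> H y4 y3 y2 y1 h4 e4 e3 e2 e1 e5.
have -> : y1 = 2 * H - 1 by lra.
have f4 : 24 * y4 = (2 * H - 1) * (2 * H - 2) * (2 * H - 3) * (2 * H - 4) by lra.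
have f3 : 6 * y3 = ((2 * H - 1) * (2 * H - 2) * (2 * H - 3)) by lra.
have f2 : 2 * y2 = ((2 * H - 1) * (2 * H - 2)) by lra.
have f5 : 24 * h4 = (H * (H - 1) * (H - 2) * (H - 3)) by lra.
have : 3 * (128 * h4) = 3 * (- 5 + 5 * (2 * H - 1) - 2 * y2 - 4 * y3 + 8 * y4).
  have -> : 3 * (128 * h4) = 16 * (24 * h4) by ring.
  rewrite f5 !mulrDr; lra.
lra.
Qed.

(** The same Newton expansion for [2 ^ 10 * 'C(h, 6)], where the coefficient of ['C(y, 3)] is
    zero. *)
Lemma half_bin6 (h y : nat) : h.*2 = y.+1 ->
  1024 * ('C(h, 6))%:R = - 21 + 21 * ('C(y, 1))%:R - 14 * ('C(y, 2))%:R
    + 16 * ('C(y, 4))%:R - 24 * ('C(y, 5))%:R + 16 * ('C(y, 6))%:R :> int.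
Proof.
move=> hy; have := natr_bin_fact h 6; have := natr_bin_fact y 1.
have := natr_bin_fact y 2; have := natr_bin_fact y 4.
have := natr_bin_fact y 5; have := natr_bin_fact y 6.
have -> : y%:R = 2 * h%:R - 1 :> int by lia.
rewrite !big_ord_recr !big_ord0 /= !factS fact0.
move: h%:R ('C(y, 6))%:R ('C(y, 5))%:R ('C(y, 4))%:R ('C(y, 2))%:R ('C(y, 1))%:R
  ('C(h, 6))%:R.
move=> H y6 y5 y4 y2 y1 h6 e6 e5 e4 e2 e1 e.
have -> : y1 = 2 * H - 1 by lra.
have f6 : 720 * y6 = (2 * H - 1) * (2 * H - 2) * (2 * H - 3) * (2 * H - 4)
   * (2 * H - 5) * (2 * H - 6) by lra.
have f5 : 120 * y5 = (2 * H - 1) * (2 * H - 2) * (2 * H - 3) * (2 * H - 4)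
   * (2 * H - 5) by lra.
have f4 : 24 * y4 = (2 * H - 1) * (2 * H - 2) * (2 * H - 3) * (2 * H - 4).
  by lra.
have f2 : 2 * y2 = (2 * H - 1) * (2 * H - 2) by lra.
have f : 720 * h6 = H * (H - 1) * (H - 2) * (H - 3) * (H - 4) * (H - 5) by lra.
have : 64 * (720 * h6) = - 945 + 945 * (2 * H - 1) - 315 * (2 * y2)
  + 30 * (24 * y4) - 9 * (120 * y5) + 720 * y6.
  by rewrite f f2 f4 f5 f6; ring.
lra.
Qed.
End HalfBinomials.

(** * Evaluation of the arithmetic conditions with binary integers *)

Section BinaryCheck.
Import BinNat.
Local Notation n2N := N.of_nat.

Lemma n2N_mul a b : n2N (a * b) = N.mul (n2N a) (n2N b).
Proof. exact: Nnat.Nat2N.inj_mul. Qed.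

Lemma n2N_add a b : n2N (a + b) = N.add (n2N a) (n2N b).
Proof. exact: Nnat.Nat2N.inj_add. Qed.

Lemma n2N_div x y a b : 0 < b -> x * b = y * a ->
  N.div (N.mul (n2N y) (n2N a)) (n2N b) = n2N x.
Proof.
move=> b0 e; rewrite -n2N_mul -e n2N_mul N.div_mul //.
by case: b b0 {e}.
Qed.

(** Each division is exact by [(k + 1) * 'C(n, k + 1) = (n - k) * 'C(n, k)]; the recursion stays
    linear in [k] for [vm_compute]. *)
Fixpoint binN (n k : nat) : N :=
  if k is k'.+1 then N.div (N.mul (binN n k') (n2N (n - k'))) (n2N k)
  else N.of_nat 1.

Lemma binNE n k : binN n k = n2N 'C(n, k).
Proof.
elim: k => [|k IHk]; first by rewrite bin0.
have -> : binN n k.+1 = N.div (N.mul (binN n k) (n2N (n - k))) (n2N k.+1) by [].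
rewrite IHk; apply: n2N_div => //.
by rewrite mulnC mul_bin_left mulnC.
Qed.

Definition lambdaN_up (l : N) (m s : nat) :=
  N.div (N.mul l (n2N (4 * m + 4 - s))) (n2N (24 * m - s)).
Definition lambdaN_down (l : N) (m s : nat) :=
  N.div (N.mul l (n2N (24 * m - s))) (n2N (4 * m + 4 - s)).
Definition exact_up (l l' : N) (m s : nat) :=
  N.eqb (N.mul l' (n2N (24 * m - s))) (N.mul l (n2N (4 * m + 4 - s))).

(* The list [lambda_2, ..., lambda_8]; the last three entries are meaningful only
   when the divisions tested by [exact_up] are exact. *)
Definition lambdaN (m : nat) : seq N :=
  let l5 := binN (5 * m - 2) (m - 1) in
  let l4 := lambdaN_down l5 m 4 in
  let l3 := lambdaN_down l4 m 3 in
  let l2 := lambdaN_down l3 m 2 in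
  let l6 := lambdaN_up l5 m 5 in
  let l7 := lambdaN_up l6 m 6 in
  let l8 := lambdaN_up l7 m 7 in
  [:: l2; l3; l4; l5; l6; l7; l8].

(* The congruences come from summing [half_bin4], [half_bin6] over the blocks. *)
Definition check7 (m : nat) : bool :=
  if lambdaN m is [:: l2; l3; l4; l5; l6; l7; l8] then
  let c := binN (4 * m + 3) in
  [&& exact_up l5 l6 m 5, exact_up l6 l7 m 6 &
  N.eqb (N.modulo (N.add (N.mul 5 (N.mul (c 1) l3))
                         (N.mul 8 (N.mul (c 4) l6))) 128)
        (N.modulo (N.add (N.mul 5 l2) (N.add (N.mul 2 (N.mul (c 2) l4))
                         (N.mul 4 (N.mul (c 3) l5)))) 128)]
  else false.

Definition check8 (m : nat) : bool :=
  if lambdaN m is [:: l2; l3; l4; l5; l6; l7; l8] then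
  let c := binN (4 * m + 3) in
  exact_up l7 l8 m 7 &&
  N.eqb (N.modulo (N.add (N.mul 21 (N.mul (c 1) l3))
    (N.add (N.mul 16 (N.mul (c 4) l6)) (N.mul 16 (N.mul (c 6) l8)))) 1024)
        (N.modulo (N.add (N.mul 21 l2) (N.add (N.mul 14 (N.mul (c 2) l4))
                         (N.mul 24 (N.mul (c 5) l7)))) 1024)
  else false.

Definition exceptional := [:: 15; 52; 55; 57; 59; 60; 63; 90; 93; 104; 105;
  107; 118; 125; 127; 135; 143; 151].

Lemma check7_exceptional :
  all (fun m => check7 m ==> (m \in exceptional)) (iota 1 153).
Proof. by vm_compute. Qed.

Lemma check8_exceptional : ~~ has check8 exceptional.
Proof. by vm_compute. Qed.

Section Bridge.
Variables (m : nat) (L : nat -> nat).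
Hypothesis m_gt0 : 0 < m.
Hypothesis L5 : L 5 = 'C(5 * m - 2, m - 1).

Lemma lambdaN_upE s : s < 24 -> L s * (4 * m + 4 - s) = L s.+1 * (24 * m - s) ->
  lambdaN_up (n2N (L s)) m s = n2N (L s.+1).
Proof. by move=> s24 e; apply: n2N_div; [lia | rewrite e]. Qed.

Lemma lambdaN_downE s : s < 8 -> L s * (4 * m + 4 - s) = L s.+1 * (24 * m - s) ->
  lambdaN_down (n2N (L s.+1)) m s = n2N (L s).
Proof. by move=> s8 e; apply: n2N_div; [lia | rewrite e]. Qed.

(** The last entry stays a formal quotient, since a 7-design provides no relation for [L 8]. *)
Lemma lambdaNE t : 7 <= t ->
  (forall r, r < t -> L r * (4 * m + 4 - r) = L r.+1 * (24 * m - r)) ->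
  lambdaN m = [:: n2N (L 2); n2N (L 3); n2N (L 4); n2N (L 5); n2N (L 6);
    n2N (L 7); lambdaN_up (n2N (L 7)) m 7].
Proof.
move=> t7 LE; have {}LE r : r < 7 ->
    L r * (4 * m + 4 - r) = L r.+1 * (24 * m - r) by move=> r7; apply: LE; lia.
rewrite /lambdaN binNE -L5 (lambdaN_downE _ (LE 4 _)) //.
rewrite (lambdaN_downE _ (LE 3 _)) // (lambdaN_downE _ (LE 2 _)) //.
by rewrite (lambdaN_upE _ (LE 5 _)) // (lambdaN_upE _ (LE 6 _)).
Qed.

Lemma exact_upE s : L s * (4 * m + 4 - s) = L s.+1 * (24 * m - s) ->
  exact_up (n2N (L s)) (n2N (L s.+1)) m s.
Proof. by move=> e; rewrite /exact_up -!n2N_mul e N.eqb_refl. Qed.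

Lemma eq_mod_n2N k x a b : k != 0 -> k * x + b = a ->
  N.eqb (N.modulo (n2N a) (n2N k)) (N.modulo (n2N b) (n2N k)).
Proof.
move=> k0 <-; rewrite n2N_add n2N_mul N.add_comm N.mul_comm.
by rewrite N.Div0.mod_add N.eqb_refl.
Qed.

(** The negative terms of the summed expansion are moved across, so that it holds over the naturals;
    [x] is the quotient witnessing the congruence modulo 128. *)
Lemma check7_true x :
  (forall r, r < 7 -> L r * (4 * m + 4 - r) = L r.+1 * (24 * m - r)) ->
  128 * x + (5 * L 2 + (2 * ('C(4 * m + 3, 2) * L 4)
     + 4 * ('C(4 * m + 3, 3) * L 5))) =
  5 * ('C(4 * m + 3, 1) * L 3) + 8 * ('C(4 * m + 3, 4) * L 6) ->
  check7 m.
Proof.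
move=> LE e; rewrite /check7 (@lambdaNE 7) // !exact_upE ?LE // !binNE.
by have := @eq_mod_n2N 128 x _ _ isT e; rewrite !(n2N_add, n2N_mul).
Qed.

Lemma check8_true x :
  (forall r, r < 8 -> L r * (4 * m + 4 - r) = L r.+1 * (24 * m - r)) ->
  1024 * x + (21 * L 2 + (14 * ('C(4 * m + 3, 2) * L 4)
     + 24 * ('C(4 * m + 3, 5) * L 7))) =
  21 * ('C(4 * m + 3, 1) * L 3) + (16 * ('C(4 * m + 3, 4) * L 6)
     + 16 * ('C(4 * m + 3, 6) * L 8)) ->
  check8 m.
Proof.
move=> LE e; rewrite /check8 (@lambdaNE 8) // lambdaN_upE ?LE //.
rewrite exact_upE ?LE // !binNE.
by have := @eq_mod_n2N 1024 x _ _ isT e; rewrite !(n2N_add, n2N_mul).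
Qed.
End Bridge.
End BinaryCheck.

(** * The support design of minimum weight *)

Section Support.
Variable m : nat.
Hypothesis m_gt0 : 0 < m.
Variable C : {vspace 'rV['F_2]_(24 * m)}.
Hypothesis exC : extremal_de_sd_code C.
Local Notation D := (support_design C (4 * m + 4)).
Implicit Types (T b : {set 'I_(24 * m)}) (L : nat -> nat).

Lemma exists_block : exists2 c, c \in C & wt c = 4 * m + 4.
Proof. by have [_ _ [_ [[c [cC _ cw]] _]]] := exC; exists c. Qed.

(** Adding the all-one word exchanges blocks disjoint from [T] with words of weight [20 m - 4]
    containing [T]. *)
Lemma card_disjoint_nwords T :
  #|[set b in D | [disjoint T & b]]| = nwords C T (20 * m - 4).
Proof.
have f_inj : injective (fun c : 'rV['F_2]_(24 * m) => supp (c + ones _)%R).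
  by move=> c c' /supp_inj /addIr.
have onesC := ones_code exC.
rewrite /nwords -(card_imset _ f_inj); apply: eq_card => b.
have suppC (c : 'rV['F_2]_(24 * m)) : supp (c + ones _)%R = ~: supp c.
  by rewrite supp_add supp_ones setDT set0U setTD.
rewrite inE; apply/andP/imsetP => [[/imsetP[c]]|[c]].
  rewrite !inE => /andP[cC /eqP cw] -> Tc; exists (c + ones _)%R; last first.
    by rewrite suppC suppC setCK.
  rewrite !inE rpredD // wt_compl cw suppC -disjoints_subset Tc andbT /=.
  by apply/eqP; lia.
rewrite !inE => /and3P[cC /eqP cw Tc] ->; split.
  apply/imsetP; exists (c + ones _)%R => //.
  by rewrite inE rpredD // wt_compl cw /=; apply/eqP; lia.
by rewrite suppC disjoints_subset setCK.
Qed.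

Lemma support_design_params t : is_t_design D t -> exists L,
  (forall s, s <= t -> is_design D s (24 * m) (4 * m + 4) (L s)) /\
  (forall s, s < t -> L s * (4 * m + 4 - s) = L s.+1 * (24 * m - s)).
Proof.
case=> v [k [l dD]].
have [L [_ dL LE]] := design_lambdas dD.
(* [is_t_design] leaves the block size free; an actual block fixes it. *)
have [c cC cw] := exists_block.
have [_ vX kD _] := dD.
have ek : k = 4 * m + 4.
  by rewrite -(kD (supp c)) //; apply/imsetP; exists c; rewrite ?inE ?cC ?cw /=.
have ev : v = 24 * m by rewrite -vX card_ord.
by move: dL LE; rewrite ek ev => dL LE; exists L.
Qed.

Lemma design6_design7 L :
  (forall s, s <= 6 -> is_design D s (24 * m) (4 * m + 4) (L s)) ->
  is_t_design D 7.
Proof.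
move=> dL; have dX := deg_family dL.
have [T0 T07] : exists T, #|T| = 7.
  by apply: exists_set_card; rewrite card_ord; lia.
have [_ vX kD _] := dL 0 isT.
exists (24 * m), (4 * m + 4), (deg D T0); split=> //; first lia.
move=> T T7; rewrite -/(deg D T).
have h := card_disjoint_blocks_const dX T7 T07.
have [c0 hc] := lambda7_affine m_gt0 exC.
have := hc T T7; have := hc T0 T07.
move: h; rewrite !card_disjoint_nwords /deg !nblocks_nwords natrD.
have := expn_gt0 2 (12 * m - 7); have := expn_gt0 8 (4 * m - 3).
move: (2 ^ _) (8 ^ _) (nwords C T (4 * m + 4)) (nwords C T (20 * m - 4)).
move: (nwords C T0 (4 * m + 4)) (nwords C T0 (20 * m - 4)).
move=> w w' x y u u' /= y0 x0 e1 e2 e3.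
have e1' : (u'%:R = w'%:R + w%:R - u%:R :> int)%R by lra.
(* With [x], [y] the two powers and [u], [w] the block counts of [T], [T0]: subtracting the affine
   relations gives [(x + y)(u - w) = y (u' - w')], and [e1'] gives [u' - w' = w - u]. The total
   factor [x + 2 y] is positive. *)
have : ((x + y + y)%:R * (u%:R - w%:R) = 0 :> int)%R.
  rewrite e1' in e3; rewrite !natrD; lra.
move/eqP; rewrite mulf_eq0 pnatr_eq0 subr_eq0 eqr_nat; case/orP; last by move/eqP.
by rewrite !addn_eq0; lia.
Qed.

Lemma lambda5_value L :
  is_design D 5 (24 * m) (4 * m + 4) (L 5) -> L 5 = 'C(5 * m - 2, m - 1).
Proof.
move=> [_ _ _ degD].
have [T T5] : exists T : {set 'I_(24 * m)}, #|T| = 5.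
  by apply: exists_set_card; rewrite card_ord; lia.
by rewrite -(degD T T5) nblocks_nwords lambda5.
Qed.

(** Fix a block [c], a point [p] in it and [q] outside. A block [b] through both meets [c] in an
    even number of points, one of them [p], so it meets the other [4 m + 3] points of [c] in an odd
    number. *)
Lemma odd_intersections t L :
  (forall s, s <= t -> is_design D s (24 * m) (4 * m + 4) (L s)) ->
  exists (F : {set {set 'I_(24 * m)}}) (y : {set 'I_(24 * m)} -> nat),
    (forall b, b \in F -> odd (y b)) /\
    (forall j, 2 + j <= t ->
       \sum_(b in F) 'C(y b, j) = 'C(4 * m + 3, j) * L (2 + j)).
Proof.
move=> dL; have [c cC cw] := exists_block.
have [p pc] : exists p, p \in supp c.
  by apply/set0Pn; rewrite -card_gt0 -/(wt c) cw; lia.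
have [q qc] : exists q, q \in ~: supp c.
  by apply/set0Pn; rewrite -card_gt0 cardsCs setCK card_ord -/(wt c) cw; lia.
rewrite in_setC in qc; have pq : p != q by apply: contraNneq qc => <-.
pose P := [set p; q]; pose A := supp c :\ p.
have cP : #|P| = 2 by rewrite cards2 pq.
have cA : #|A| = 4 * m + 3.
  by have := cardsD1 p (supp c); rewrite pc -/(wt c) cw -/A; lia.
have PA : [disjoint P & A].
  rewrite disjoints_subset subUset !sub1set !in_setC !in_setD1 eqxx.
  by rewrite (negbTE qc) andbF.
exists [set b in D | P \subset b], (fun b => #|b :&: A|); split; last first.
  move=> j jt; have := sum_bin_inter dL PA (j := j); rewrite cP cA => <- //.
  by apply: eq_bigl => b; rewrite inE.
move=> b; rewrite inE => /andP[/imsetP[c' + ->]].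
rewrite inE subUset !sub1set => /andP[c'C _] /andP[pc' _].
have [sdC _ _] := exC; have := self_dual_inter_even sdC c'C cC.
rewrite (cardsD1 p) inE pc pc' /= negbK; congr odd.
by apply: eq_card => x; rewrite !inE andbCA.
Qed.

Lemma design7_check7 L :
  (forall s, s <= 7 -> is_design D s (24 * m) (4 * m + 4) (L s)) ->
  (forall s, s < 7 -> L s * (4 * m + 4 - s) = L s.+1 * (24 * m - s)) ->
  check7 m.
Proof.
move=> dL LE; have [F [y [yodd yE]]] := odd_intersections dL.
apply: (check7_true m_gt0 (lambda5_value (dL 5 isT))
  (x := \sum_(b in F) 'C((y b).+1./2, 4)) LE).
(* [(y b).+1./2] is half the size of the intersection with the fixed block. The constant term is
   written with ['C(y b, 0)] so that it sums to a multiple of [L 2]. *)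
have e : (\sum_(b in F) (128 * ('C((y b).+1./2, 4))%:R : int) =
   \sum_(b in F) (- 5 * ('C(y b, 0))%:R + 5 * ('C(y b, 1))%:R
     - 2 * ('C(y b, 2))%:R - 4 * ('C(y b, 3))%:R + 8 * ('C(y b, 4))%:R))%R.
  apply: eq_bigr => b /yodd yb; rewrite bin0 mulr1; apply: half_bin4.
  by rewrite -[RHS]odd_double_half /= yb.
move: e; rewrite !big_split /= !sumrN -!big_distrr /= -!natr_sum !yE //.
rewrite bin0 mul1n.
move: (_ * L 3) (_ * L 4) (_ * L 5) (_ * L 6) (L 2) (\sum_(b in F) _).
by move=> a1 a2 a3 a4 a0 x; lia.
Qed.

Lemma design8_check8 L :
  (forall s, s <= 8 -> is_design D s (24 * m) (4 * m + 4) (L s)) ->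
  (forall s, s < 8 -> L s * (4 * m + 4 - s) = L s.+1 * (24 * m - s)) ->
  check8 m.
Proof.
move=> dL LE; have [F [y [yodd yE]]] := odd_intersections dL.
apply: (check8_true m_gt0 (lambda5_value (dL 5 isT))
  (x := \sum_(b in F) 'C((y b).+1./2, 6)) LE).
have e : (\sum_(b in F) (1024 * ('C((y b).+1./2, 6))%:R : int) =
   \sum_(b in F) (- 21 * ('C(y b, 0))%:R + 21 * ('C(y b, 1))%:R
     - 14 * ('C(y b, 2))%:R + 16 * ('C(y b, 4))%:R - 24 * ('C(y b, 5))%:R
     + 16 * ('C(y b, 6))%:R))%R.
  apply: eq_bigr => b /yodd yb; rewrite bin0 mulr1; apply: half_bin6.
  by rewrite -[RHS]odd_double_half /= yb.
move: e; rewrite !big_split /= !sumrN -!big_distrr /= -!natr_sum !yE //.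
rewrite bin0 mul1n.
move: (_ * L 3) (_ * L 4) (_ * L 6) (_ * L 7) (_ * L 8) (L 2) (\sum_(b in F) _).
by move=> a1 a2 a4 a5 a6 a0 x; lia.
Qed.
End Support.

Theorem theorem1 (m : nat) (C : {vspace 'rV['F_2]_(24 * m)}) :
  0 < m -> m <= 153 ->
  extremal_de_sd_code C ->
  ((exists2 t : nat, 6 <= t & is_t_design (support_design C (4 * m + 4)) t) ->
     is_t_design (support_design C (4 * m + 4)) 7 /\
     m \in [:: 15; 52; 55; 57; 59; 60; 63; 90; 93; 104; 105; 107; 118; 125;
               127; 135; 143; 151]) /\
  ~ is_t_design (support_design C (4 * m + 4)) 8.
Proof.
move=> m0 m153 exC.
have main t : 6 <= t -> is_t_design (support_design C (4 * m + 4)) t ->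
    is_t_design (support_design C (4 * m + 4)) 7 /\ m \in exceptional.
  move=> t6 /(support_design_params exC)[L [dL _]].
  have d7 : is_t_design (support_design C (4 * m + 4)) 7.
    by apply: (design6_design7 m0 exC (L := L)) => s s6; apply: dL; lia.
  split=> //; have [L' [dL' LE']] := support_design_params exC d7.
  have := design7_check7 m0 exC dL' LE'; apply/implyP.
  by apply: (allP check7_exceptional); rewrite mem_iota; lia.
split=> [[t t6 dt]|d8]; first exact: main t6 dt.
(* An 8-design already forces [m] to be exceptional, so [check8] has to fail at those eighteen
   values only. *)
have [_ mex] := main 8 isT d8.
have [L [dL LE]] := support_design_params exC d8.
apply: (negP check8_exceptional); apply/hasP; exists m; first exact: mex.
exact: (design8_check8 m0 exC dL LE).
Qed.
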